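(* Let $\mathbb{F}$ be a commutative field of characteristic $0$ and let $f:\mathbb{R}^2 \to \mathbb{F}^2$ preserve unit distance. If $A,B,C,D \in \mathbb{R}^2$ and the vectors $\overrightarrow{AB}$ and $\overrightarrow{CD}$ are linearly dependent (over $\mathbb{R}$), then the vectors $\overrightarrow{f(A)f(B)}$ and $\overrightarrow{f(C)f(D)}$ are linearly dependent (over $\mathbb{F}$).
   Context: For $u=(u_1,u_2)$, $v=(v_1,v_2)\in\mathbb{F}^2$, $\varphi_2(u,v)=(u_1-v_1)^2+(u_2-v_2)^2\in\mathbb{F}$. A map $f:\mathbb{R}^2\to\mathbb{F}^2$ preserves unit distance if for all $x,y\in\mathbb{R}^2$, $|x-y|=1$ (Euclidean distance) implies $\varphi_2(f(x),f(y))=1$. For points $P,Q$ (of $\mathbb{R}^2$ or of $\mathbb{F}^2$), $\overrightarrow{PQ}=Q-P$. Two vectors $u,v$ are linearly dependent if $\alpha u+\beta v=0$ for some scalars $\alpha,\beta$ that are not both zero. *)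

(* Defs.v *)
(* The real line is represented by an arbitrary R : realType. *)
From mathcomp Require Import all_boot all_order all_algebra.
From mathcomp Require Import reals.

Set Implicit Arguments.
Unset Strict Implicit.
Unset Printing Implicit Defensive.

Import Order.TTheory GRing.Theory Num.Theory.
Local Open Scope ring_scope.

(* The two coordinates of a vector are indexed by 0 and 1 in 'I_2. *)
Definition phi2 (K : fieldType) (u v : 'rV[K]_2) : K :=
  (u 0 0 - v 0 0) ^+ 2 + (u 0 1 - v 0 1) ^+ 2.

(* Defined explicitly because the norm that MathComp-Analysis puts on matrices
   is the sup norm. *)
Definition eucl_dist (R : realType) (x y : 'rV[R]_2) : R :=
  Num.sqrt (phi2 x y).

Definition preserves_unit_distance (R : realType) (F : fieldType)
    (f : 'rV[R]_2 -> 'rV[F]_2) : Prop :=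
  forall x y : 'rV[R]_2, eucl_dist x y = 1 -> phi2 (f x) (f y) = 1.

Definition vec (K : fieldType) (P Q : 'rV[K]_2) : 'rV[K]_2 := Q - P.

Definition lin_dependent (K : fieldType) (u v : 'rV[K]_2) : Prop :=
  exists alpha beta : K,
    ~ (alpha = 0 /\ beta = 0) /\ alpha *: u + beta *: v = 0.

(* Main.v *)
Require Import Defs.
From mathcomp Require Import all_boot all_order all_algebra.
From mathcomp Require Import reals.
From mathcomp Require Import ring lra.
Import Order.TTheory GRing.Theory Num.Theory.
Local Open Scope ring_scope.

(** The proof shows that a unit-distance preserving map [f] is additive up to a
    translation and then that the additive part maps each line through the
    origin into a line through the origin.

    In [F]^2, as in the plane, the fourth vertex of a rhombus with sides of
    length 1 is determined by the other three as soon as both diagonals are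
    nonzero vectors ([rhombus_diagonals]); isotropic diagonals do no harm.  So
    [f] maps a unit rhombus to a parallelogram provided it does not collapse
    either diagonal.  It does not collapse distance 1, hence not distance
    sqrt 3 ([separates3]); the rhombi of the triangular lattice therefore go to
    parallelograms, and natural distances are preserved ([natural_dist]).  Two
    points at distance at least 1 are at distances [n] and [n + 1] from a
    common third point for some [n], and n^2 and (n+1)^2 differ in [F], so [f]
    separates them ([separates_ge1]).  Now every unit rhombus whose angle is
    between 60 and 120 degrees goes to a parallelogram.  The vectors that form
    with [u] a figure mapped to a parallelogram, wherever it is placed, are a
    subgroup of the plane, and this interval of angles is enough to generate
    the whole plane ([parallelogram_all]).  In other words
    [G w = f (p + w) - f p] does not depend on [p], and [G] is additive.

    Fix a unit vector [e] and let [g x = G (x e)].  Right triangles with legs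
    along [e] and its perpendicular and with a natural hypotenuse yield a
    Pythagorean relation between images.  Two such triangles with a common leg
    give [g x . g (1/x) = 1] ([inverse_dot]), and, both being orthogonal to the
    image of the common leg, [g x] parallel to [g (1/x)] ([inverse_parallel]).
    Reading vectors as elements of [F][i] with [g 1] as unit, this says that
    [g (1/x)] is the inverse of the conjugate of [g x].  By Hua's trick
    [g] then preserves squares, so it would also commute with inversion without
    conjugation: [g x] is its own conjugate and lies on the line of [g 1]
    ([conjugate_inverse_real]).  Parallel vectors thus have parallel images. *)

Set Implicit Arguments.
Unset Strict Implicit.
Unset Printing Implicit Defensive.

(** * Vectors in coordinates *)

Lemma add_morph0 (U V : zmodType) (g : U -> V) :
  {morph g : x y / x + y} -> g 0 = 0.
Proof. by move=> gD; apply: (addIr (g 0)); rewrite -gD !add0r. Qed.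

Lemma add_morphN (U V : zmodType) (g : U -> V) :
  {morph g : x y / x + y} -> {morph g : x / - x}.
Proof.
by move=> gD x; apply: (addIr (g x)); rewrite -gD !addNr (add_morph0 gD).
Qed.

Lemma natr_eq0_char0 (F : fieldType) :
  [pchar F] =i pred0 -> forall n, (n%:R == 0 :> F) = (n == 0%N).
Proof. by move=> h; exact: (proj1 (pcharf0P F) h). Qed.

Definition dot (K : fieldType) (u v : 'rV[K]_2) : K :=
  u 0 0 * v 0 0 + u 0 1 * v 0 1.

(** The rotation by a right angle; it makes sense over every field. *)
Definition turn (K : fieldType) (u : 'rV[K]_2) : 'rV[K]_2 :=
  \row_j (if j == 0 then - u 0 1 else u 0 0).

Lemma rowP2 (K : fieldType) (u v : 'rV[K]_2) :
  u 0 0 = v 0 0 -> u 0 1 = v 0 1 -> u = v.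
Proof.
move=> h0 h1; apply/rowP => j; case: (unliftP 0 j) => [i ->|->] //.
by rewrite (ord1 i) (_ : lift 0 0 = 1) //; apply/val_inj.
Qed.

Lemma phi2E (K : fieldType) (x y : 'rV[K]_2) : phi2 x y = dot (y - x) (y - x).
Proof. by rewrite /phi2 /dot !mxE; ring. Qed.

Lemma dot_turn (K : fieldType) (u : 'rV[K]_2) : dot (turn u) (turn u) = dot u u.
Proof. by rewrite /dot !mxE /=; ring. Qed.

(** The vectors orthogonal to [d] form a line also when [d] is isotropic; in
    that case [turn d] is a multiple of [d]. *)
Lemma orthogonal_turn (K : fieldType) (d q : 'rV[K]_2) :
  d != 0 -> dot q d = 0 -> exists c, q = c *: turn d.
Proof.
move=> d0 qd.
have [d00|d00] := eqVneq (d 0 0) 0.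
  have d01 : d 0 1 != 0.
    apply: contraNneq d0 => d01; apply/eqP; apply: rowP2; by rewrite !mxE.
  exists (- q 0 0 / d 0 1); move: qd; rewrite /dot d00 => qd.
  have q1 : q 0 1 = 0 by apply: (mulIf d01); rewrite mul0r -qd; ring.
  by apply: rowP2; rewrite !mxE /= ?q1 ?d00 ?mulr0 //; field.
exists (q 0 1 / d 0 0); apply: rowP2; rewrite !mxE /=; last by rewrite divfK.
apply: (mulIf d00); move/eqP: qd; rewrite /dot addr_eq0 => /eqP ->.
by field.
Qed.

(** Coordinates relative to [u] and its rotation: squared lengths of explicit
    figures drawn on [u] reduce to scalar identities by [dot_frame]. *)
Definition frame (K : fieldType) (u : 'rV[K]_2) (x y : K) : 'rV[K]_2 :=
  x *: u + y *: turn u.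

Lemma dot_frame (K : fieldType) (u : 'rV[K]_2) x y z t :
  dot (frame u x y) (frame u z t) = (x * z + y * t) * dot u u.
Proof. by rewrite /dot /frame !mxE /=; ring. Qed.

Lemma dot_self_frame (K : fieldType) (u : 'rV[K]_2) x y :
  dot u (frame u x y) = x * dot u u.
Proof. by rewrite /dot /frame !mxE /=; ring. Qed.

Lemma dot_turn_frame (K : fieldType) (u : 'rV[K]_2) x y z t :
  dot (turn (frame u x y)) (frame u z t) = (x * t - y * z) * dot u u.
Proof. by rewrite /dot /frame !mxE /=; ring. Qed.

Lemma frameD (K : fieldType) (u : 'rV[K]_2) x y z t :
  frame u x y + frame u z t = frame u (x + z) (y + t).
Proof. by rewrite /frame !scalerDl addrACA. Qed.

Lemma frameN (K : fieldType) (u : 'rV[K]_2) x y :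
  - frame u x y = frame u (- x) (- y).
Proof. by rewrite /frame !scaleNr opprD. Qed.

Lemma frame10 (K : fieldType) (u : 'rV[K]_2) : frame u 1 0 = u.
Proof. by rewrite /frame scale1r scale0r addr0. Qed.

Lemma frame_span (K : fieldType) (u w : 'rV[K]_2) :
  dot u u = 1 -> w = frame u (dot u w) (dot (turn u) w).
Proof.
by move=> uu; rewrite -[LHS]scale1r -uu; apply: rowP2;
  rewrite /frame /dot !mxE /=; ring.
Qed.

Lemma dotZZ (K : fieldType) (c : K) (u : 'rV[K]_2) :
  dot (c *: u) (c *: u) = c ^+ 2 * dot u u.
Proof. by rewrite /dot !mxE; ring. Qed.

Lemma dot_gt0 (R : realType) (u : 'rV[R]_2) : u != 0 -> 0 < dot u u.
Proof.
move=> u0; rewrite lt0r addr_ge0 -?expr2 ?sqr_ge0 // andbT /dot -!expr2.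
rewrite paddr_eq0 ?sqr_ge0 // !sqrf_eq0; apply: contra u0.
move=> /andP[/eqP h0 /eqP h1].
by apply/eqP/rowP2; rewrite !mxE.
Qed.

Lemma unit_direction (R : realType) (w : 'rV[R]_2) :
  w != 0 -> exists e s, dot e e = 1 /\ w = s *: e.
Proof.
move=> w0; have n0 := dot_gt0 w0; set c := Num.sqrt (dot w w).
have c0 : c != 0 by rewrite sqrtr_eq0 -ltNge.
exists (c^-1 *: w), c; rewrite dotZZ exprVn sqr_sqrtr ?ltW // mulVf ?gt_eqF //.
by rewrite scalerA divff // scale1r.
Qed.

(** * Unit rhombi over a field *)

(** Both [q] and [a + b] are orthogonal to the diagonal [a - b], hence multiples
    [c] and [m] of its rotation, and the length conditions give
    [dot q q = dot q (a + b)].  Cancelling [c] and the squared length of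
    [a - b] leaves [c = m].  The latter is nonzero although isotropic vectors
    may exist: otherwise both diagonals would be isotropic, but their squared
    lengths add up to 4. *)
Lemma rhombus_diagonals (K : fieldType) (q a b : 'rV[K]_2) :
  2%:R != 0 :> K ->
  dot a a = 1 -> dot b b = 1 -> dot (q - a) (q - a) = 1 ->
  dot (q - b) (q - b) = 1 -> a != b -> q != 0 -> q = a + b.
Proof.
move=> two0 aa bb qa qb ab q0.
have d0 : a - b != 0 by rewrite subr_eq0.
have [c qE] : exists c, q = c *: turn (a - b).
  apply: orthogonal_turn => //; apply: (mulfI two0).
  have -> : 2%:R * dot q (a - b) = dot (q - b) (q - b) - dot (q - a) (q - a)
    + dot a a - dot b b by rewrite /dot !mxE; ring.
  by rewrite aa bb qa qb; ring.
have [m sE] : exists m, a + b = m *: turn (a - b).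
  apply: orthogonal_turn => //.
  have -> : dot (a + b) (a - b) = dot a a - dot b b by rewrite /dot !mxE; ring.
  by rewrite aa bb subrr.
have qs : dot q q = dot q (a + b).
  apply: (mulfI two0).
  have -> : 2%:R * dot q (a + b) = dot q q + dot q q + dot a a + dot b b
    - dot (q - a) (q - a) - dot (q - b) (q - b) by rewrite /dot !mxE; ring.
  by rewrite aa bb qa qb; ring.
have dE : dot (turn (a - b)) (turn (a - b)) * (1 + m ^+ 2) = 2%:R * 2%:R.
  have <- : dot (a - b) (a - b) + dot (a + b) (a + b) = 2%:R * 2%:R.
    have -> : dot (a - b) (a - b) + dot (a + b) (a + b)
      = 2%:R * (dot a a + dot b b) by rewrite /dot !mxE; ring.
    by rewrite aa bb; ring.
  by rewrite sE -[dot (a - b) _]dot_turn /dot !mxE; ring.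
have c0 : c != 0 by apply: contraNneq q0 => c0; rewrite qE c0 scale0r.
have n0 : dot (turn (a - b)) (turn (a - b)) != 0.
  by apply: contraNneq (mulf_neq0 two0 two0) => n0; rewrite -dE n0 mul0r.
rewrite sE qE; congr (_ *: _); apply: (mulfI c0); apply: (mulIf n0).
transitivity (dot q q); first by rewrite qE /dot !mxE; ring.
by rewrite qs sE qE /dot !mxE; ring.
Qed.

(** * Translation-invariant displacements *)

(** Read as an equality of displacements, the condition says that the
    displacement of [f] along [u] has period [v]; this makes closure under sums
    in [v] immediate. *)
Definition preserves_parallelograms (U V : zmodType) (f : U -> V) (u v : U) :=
  forall p, f (p + v + u) - f (p + v) = f (p + u) - f p.

Section Parallelograms.
Variables (U V : zmodType) (f : U -> V).
Local Notation par := (preserves_parallelograms f).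

Lemma parallelogramC u v : par u v -> par v u.
Proof.
move=> h p; have -> : f (p + u + v) = f (p + u) - f p + f (p + v).
  by rewrite -h subrK addrAC.
by rewrite addrAC [_ - _ - _]addrAC subrr add0r addrC.
Qed.

Lemma parallelogram0 u : par u 0.
Proof. by move=> p; rewrite !addr0. Qed.

Lemma parallelogramD u v w : par u v -> par u w -> par u (v + w).
Proof. by move=> hv hw p; rewrite addrA hw hv. Qed.

Lemma parallelogramN u v : par u v -> par u (- v).
Proof. by move=> hv p; rewrite -(hv (p - v)) subrK. Qed.

Lemma parallelogramMn u v n : par u v -> par u (v *+ n).
Proof.
move=> hv; elim: n => [|n IHn]; first exact: parallelogram0.
by rewrite mulrS; exact: parallelogramD.
Qed.

Lemma displacement_muln u n p :
  par u u -> f (p + u *+ n) - f p = (f (p + u) - f p) *+ n.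
Proof.
move=> h; elim: n => [|n IHn]; first by rewrite addr0 subrr.
by rewrite !mulrSr -IHn -(parallelogramMn n h p) [RHS]addrC subrKA addrA.
Qed.

End Parallelograms.

(** * Unit distances force additivity *)

Section UnitDistance.
Variables (R : realType) (F : fieldType) (f : 'rV[R]_2 -> 'rV[F]_2).
Hypothesis charF0 : [pchar F] =i pred0.
Hypothesis f_dist :
  forall x y, dot (y - x) (y - x) = 1 -> dot (f y - f x) (f y - f x) = 1.

Local Notation par := (preserves_parallelograms f).

(** Here [d] is a squared distance. *)
Definition separates (d : R) :=
  forall p v, dot v v = d -> f (p + v) != f p.

Lemma f_unit p u :
  dot u u = 1 -> dot (f (p + u) - f p) (f (p + u) - f p) = 1.
Proof. by move=> uu; apply: f_dist; rewrite addrC addKr. Qed.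

Lemma separates1 : separates 1.
Proof.
move=> p v /(f_unit p); apply: contra_eq_neq => ->.
by rewrite subrr /dot !mxE mul0r addr0 eq_sym oner_neq0.
Qed.

Lemma rhombus_image p u v :
  dot u u = 1 -> dot v v = 1 -> f (p + u) != f (p + v) ->
  f (p + v + u) != f p ->
  f (p + v + u) - f p = f (p + u) - f p + (f (p + v) - f p).
Proof.
move=> uu vv huv hq; apply: rhombus_diagonals;
  rewrite ?(natr_eq0_char0 charF0) ?f_unit //.
- by rewrite opprB addrA subrK addrAC f_unit.
- by rewrite opprB addrA subrK f_unit.
- by apply: contraNneq huv => /addIr ->.
- by rewrite subr_eq0.
Qed.

Lemma parallelogram_rhombus u v :
  dot u u = 1 -> dot v v = 1 -> separates (dot (u - v) (u - v)) ->
  separates (dot (u + v) (u + v)) -> par u v.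
Proof.
move=> uu vv hB hD p.
have h1 : f (p + u) != f (p + v).
  by have := hB (p + v) _ erefl; rewrite addrA addrAC addrK.
have h2 : f (p + v + u) != f p.
  by have := hD p _ erefl; rewrite addrA addrAC.
have := rhombus_image uu vv h1 h2.
by move=> /(canRL (subrK _)) ->; rewrite -[X in X - _]addrA subrK addrK.
Qed.

(** A segment of length sqrt 3 is the long diagonal of a rhombus made of two
    equilateral triangles; the short one has length 1 and does not collapse. *)
Lemma dist3_image p v : dot v v = 3 -> f (p + v) != f p ->
  dot (f (p + v) - f p) (f (p + v) - f p) = 3.
Proof.
move=> vv hv.
(* The other two vertices are at distance 1/2, that is [y] times sqrt 3, from
   the midpoint of the segment. *)
have [y y2] : exists y : R, y ^+ 2 = 12^-1.
  by exists (Num.sqrt 12^-1); rewrite sqr_sqrtr ?invr_ge0.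
set a := frame v 2^-1 y; set b := frame v 2^-1 (- y).
have abE : p + b + a = p + v.
  by rewrite -addrA frameD addNr (_ : _ + _ = 1) ?frame10 //; field.
have aa : dot a a = 1 by rewrite dot_frame vv; lra.
have bb : dot b b = 1 by rewrite dot_frame vv; lra.
have ba : dot (b - a) (b - a) = 1 by rewrite frameN frameD dot_frame vv; lra.
have fba : dot (f (p + b) - f (p + a)) (f (p + b) - f (p + a)) = 1.
  by apply: f_dist; rewrite opprD addrACA subrr add0r.
have hab : f (p + a) != f (p + b).
  by have := separates1 (p + a) ba; rewrite -addrA [a + _]addrC subrK eq_sym.
have := rhombus_image aa bb hab; rewrite abE => -> //.
have fa := f_unit p aa; have fb := f_unit p bb.
set q := f (p + a) - f p; set r := f (p + b) - f p.
have -> : dot (q + r) (q + r) = 2 * (dot q q + dot r r)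
    - dot (f (p + b) - f (p + a)) (f (p + b) - f (p + a)).
  by rewrite /q /r /dot !mxE; ring.
by rewrite fa fb fba; ring.
Qed.

(** If [p] and [p + v] had the same image, choose [z] with [p + z] at distance
    sqrt 3 from [p] and 1 from [p + v].  The image of [p + z] would be at
    squared distance both 3 and 1 from the common image. *)
Lemma separates3 : separates 3.
Proof.
move=> p v vv; apply/eqP => pv.
have [y y2] : exists y : R, y ^+ 2 = 11 / 36.
  by exists (Num.sqrt (11 / 36)); rewrite sqr_sqrtr // divr_ge0.
set z := frame v (5 / 6) y.
have zz : dot z z = 3 by rewrite dot_frame vv; lra.
have zv : dot (z - v) (z - v) = 1.
  by rewrite -[v](frame10 v) frameN frameD dot_frame vv; lra.
have pz : p + v + (z - v) = p + z by rewrite [z - v]addrC addrA addrK.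
have fz : f (p + z) != f p.
  by rewrite -pz -pv; apply: separates1 zv.
have := dist3_image zz fz; rewrite -pv -pz f_unit // => /eqP.
rewrite eq_sym -subr_eq0 (_ : 3 - 1 = 2); last by ring.
by rewrite (natr_eq0_char0 charF0 2).
Qed.

(** The rotations of [u] by 60 and by 120 degrees are periods, because the
    rhombi that they form with [u] have diagonals 1 and sqrt 3; [u] is their
    difference. *)
Lemma parallelogram_unit_self u : dot u u = 1 -> par u u.
Proof.
move=> uu.
have [y y2] : exists y : R, y ^+ 2 = 3 / 4.
  by exists (Num.sqrt (3 / 4)); rewrite sqr_sqrtr // divr_ge0.
have h60 : par u (frame u 2^-1 y).
  apply: parallelogram_rhombus; rewrite // ?dot_frame ?uu; first by lra.
  - by rewrite -{1 3}[u](frame10 u) frameN frameD dot_frame uu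
      (_ : _ * 1 = 1); [exact: separates1 | lra].
  - by rewrite -{1 3}(frame10 u) frameD dot_frame uu
      (_ : _ * 1 = 3); [exact: separates3 | lra].
have h120 : par u (frame u (- 2^-1) y).
  apply: parallelogram_rhombus; rewrite // ?dot_frame ?uu; first by lra.
  - by rewrite -{1 3}[u](frame10 u) frameN frameD dot_frame uu
      (_ : _ * 1 = 3); [exact: separates3 | lra].
  - by rewrite -{1 3}(frame10 u) frameD dot_frame uu
      (_ : _ * 1 = 1); [exact: separates1 | lra].
have := parallelogramD h60 (parallelogramN h120).
rewrite frameN frameD subrr opprK.
by rewrite (_ : _ + _ = 1) ?frame10 //; field.
Qed.

Lemma natural_dist n p w : dot w w = n%:R ^+ 2 ->
  dot (f (p + w) - f p) (f (p + w) - f p) = n%:R ^+ 2.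
Proof.
case: n => [|n] ww.
  have -> : w = 0.
    apply/eqP; apply/contra_eqT: ww => /dot_gt0.
    by rewrite expr0n lt0r => /andP[].
  by rewrite addr0 subrr /dot !mxE mulr0 addr0 expr0n.
set u := n.+1%:R^-1 *: w.
have uu : dot u u = 1 by rewrite dotZZ ww -exprMn mulVf ?expr1n ?pnatr_eq0.
have -> : w = u *+ n.+1.
  by rewrite -scaler_nat scalerA divff ?scale1r ?pnatr_eq0.
rewrite displacement_muln; last exact: parallelogram_unit_self.
by rewrite -scaler_nat dotZZ f_unit // mulr1.
Qed.

(** Two circles around [p] and [p + v] of radii [n] and [n + 1] meet if [n] is
    large, because [v] has length at least 1.  If [p] and [p + v] had the same
    image, a common point would give [n ^ 2 = (n + 1) ^ 2] in [F], which is
    impossible in characteristic 0. *)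
Lemma separates_ge1 d : 1 <= d -> separates d.
Proof.
move=> d1 p v vv; apply/eqP => pv.
have d0 : d != 0 by lra.
have := archi_boundP (ltW (lt_le_trans ltr01 d1)); set n := Num.bound d => nd.
(* The radii are [n.+1] and [n.+2]; [x] below is the abscissa of the
   intersection points along [v], [y] their ordinate. *)
have [y y2] : exists y : R,
    y ^+ 2 = n.+1%:R ^+ 2 / d - ((1 - (2 * n.+1%:R + 1) / d) / 2) ^+ 2.
  exists (Num.sqrt (n.+1%:R ^+ 2 / d - ((1 - (2 * n.+1%:R + 1) / d) / 2) ^+ 2)).
  rewrite sqr_sqrtr //.
  set m : R := n.+1%:R; have md : d <= m by rewrite /m -natr1; lra.
  have -> : m ^+ 2 / d - ((1 - (2 * m + 1) / d) / 2) ^+ 2 =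
    (4 * m ^+ 2 * d - (2 * m + 1 - d) ^+ 2) / (4 * d ^+ 2) by field.
  rewrite divr_ge0 //; last by rewrite mulr_ge0 ?sqr_ge0.
  nra.
set x := (1 - (2 * n.+1%:R + 1) / d) / 2 in y2.
set z := frame v x y.
have zz : dot z z = n.+1%:R ^+ 2.
  by rewrite dot_frame vv -!expr2 y2 addrC subrK divfK.
have zv : dot (z - v) (z - v) = n.+2%:R ^+ 2.
  rewrite -[v](frame10 v) frameN frameD dot_frame vv subr0 -!expr2 y2.
  by rewrite /x -[n.+2%:R]natr1; field.
have pz : p + v + (z - v) = p + z by rewrite [z - v]addrC addrA addrK.
have := natural_dist p zz; rewrite -pv -pz (natural_dist _ zv) => /eqP.
rewrite -subr_eq0 (_ : _ - _ = (n.+1 + n.+2)%:R).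
  by rewrite (natr_eq0_char0 charF0 (n.+1 + n.+2)).
by rewrite natrD -[n.+2%:R]natr1; ring.
Qed.

(** Both diagonals have length at least 1 when the angle is between 60 and 120
    degrees. *)
Lemma parallelogram_unit_wide u v :
  dot u u = 1 -> dot v v = 1 -> - (1 / 2) <= dot u v <= 1 / 2 -> par u v.
Proof.
move=> uu vv /andP[h1 h2].
apply: parallelogram_rhombus => //; apply: separates_ge1.
- have -> : dot (u - v) (u - v) = dot u u + dot v v - 2 * dot u v.
    by rewrite /dot !mxE; ring.
  lra.
- have -> : dot (u + v) (u + v) = dot u u + dot v v + 2 * dot u v.
    by rewrite /dot !mxE; ring.
  lra.
Qed.

(** Periods form a subgroup, so the short vectors of a line generate it. *)
Lemma parallelogram_ray u e :
  (forall t, 0 <= t <= 1 / 4 -> par u (t *: e)) -> forall x, par u (x *: e).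
Proof.
move=> small.
have pos x : 0 <= x -> par u (x *: e).
  move=> x0; have := archi_boundP (mulr_ge0 (ler0n R 4) x0).
  set n := Num.bound _ => nx.
  have n0 : 0 < n.+1%:R :> R by rewrite ltr0n.
  rewrite -[x](@divfK _ n.+1%:R) ?pnatr_eq0 //.
  rewrite mulr_natr -scalerMnl; apply: parallelogramMn; apply: small.
  rewrite divr_ge0 ?(ltW n0) //= ler_pdivrMr // -[n.+1%:R]natr1; lra.
move=> x; have [/pos //|x0] := leP 0 x.
by rewrite -[x]opprK scaleNr; apply/parallelogramN/pos; lra.
Qed.

(** The two unit vectors are nearly perpendicular to [u]: they are reflections
    of each other in its line. *)
Lemma short_sum_of_units (u : 'rV[R]_2) t : dot u u = 1 -> 0 <= t <= 1 / 4 ->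
  exists v w, [/\ t *: u = v + w, dot v v = 1, dot w w = 1,
    - (1 / 2) <= dot u v <= 1 / 2 & - (1 / 2) <= dot u w <= 1 / 2].
Proof.
move=> uu /andP[t0 t1].
have [y y2] : exists y : R, y ^+ 2 = 1 - (t / 2) ^+ 2.
  by exists (Num.sqrt (1 - (t / 2) ^+ 2)); rewrite sqr_sqrtr //; nra.
exists (frame u (t / 2) y), (frame u (t / 2) (- y)).
rewrite !dot_frame !dot_self_frame uu; split; [|lra..].
rewrite frameD subrr /frame scale0r addr0; congr (_ *: _); by field.
Qed.

(** Along [u], periods are sums of two unit vectors nearly perpendicular to
    [u].  Across, a short multiple of [turn u] is twice [turn u] minus two unit
    vectors close to [turn u]; all have a wide angle with [u]. *)
Lemma parallelogram_unit_all u w : dot u u = 1 -> par u w.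
Proof.
move=> uu; rewrite (frame_span w uu).
apply: parallelogramD; apply: parallelogram_ray => t t01.
  have [v1 [v2 [-> ? ? ? ?]]] := short_sum_of_units uu t01.
  by apply: parallelogramD; apply: parallelogram_unit_wide.
have [t0 t1] := andP t01.
have h : 0 <= 1 - (1 - t / 2) ^+ 2 by nra.
have [x x2 hx] : exists2 x : R,
    x ^+ 2 = 1 - (1 - t / 2) ^+ 2 & - (1 / 2) <= x <= 1 / 2.
  exists (Num.sqrt (1 - (1 - t / 2) ^+ 2)); first by rewrite sqr_sqrtr.
  have := sqr_sqrtr h; have := sqrtr_ge0 (1 - (1 - t / 2) ^+ 2).
  move: (Num.sqrt _) => s s0 s2; apply/andP; split; nra.
have -> : t *: turn u = frame u 0 1 + frame u 0 1
    - (frame u x (1 - t / 2) + frame u (- x) (1 - t / 2)).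
  rewrite !frameD frameN frameD subrr oppr0 !addr0 /frame scale0r add0r.
  by congr (_ *: _); field.
have wide a b : a ^+ 2 + b ^+ 2 = 1 -> - (1 / 2) <= a <= 1 / 2 ->
    par u (frame u a b).
  move=> ab ha; apply: parallelogram_unit_wide => //.
    by rewrite dot_frame uu -!expr2 ab mulr1.
  by rewrite dot_self_frame uu mulr1.
by apply: parallelogramD;
  [apply: parallelogramD | apply/parallelogramN/parallelogramD];
  apply: wide; lra.
Qed.

(** A vector is a sum of unit vectors, up to the archimedean argument of
    [parallelogram_ray]. *)
Lemma parallelogram_all v w : par v w.
Proof.
have [->|v0] := eqVneq v 0; first by apply/parallelogramC/parallelogram0.
have [e [s [ee ->]]] := unit_direction v0.
apply/parallelogramC/parallelogram_ray => t t01.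
have [v1 [v2 [-> ? ? _ _]]] := short_sum_of_units ee t01.
by apply: parallelogramD; apply/parallelogramC/parallelogram_unit_all.
Qed.
End UnitDistance.

(** * A conjugate-inverse identity *)

(** Put [z x = a x + i * b x] in [F][i].  The last two hypotheses say that
    [z x^-1] is the inverse of the conjugate of [z x].  Applied to
    [1 / (x * (x + 1)) = 1 / x - 1 / (x + 1)], this gives
    [z (x * (x + 1)) = z x * (z x + 1)], hence [z (x ^ 2) = z x ^ 2].
    Applied to the square of [x + x^-1], the latter shows that [z x] times
    [z x^-1] is 1, so the conjugate of [z x] is [z x].  Since
    [F][i] may have zero divisors, invertibility is read off the norm [n]. *)
Lemma conjugate_inverse_real (K F : fieldType) (a b : K -> F) :
  2%:R != 0 :> F ->
  {morph a : x y / x + y} -> {morph b : x y / x + y} -> a 1 = 1 -> b 1 = 0 ->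
  (forall x, x != 0 -> a x * a x^-1 + b x * b x^-1 = 1) ->
  (forall x, x != 0 -> a x * b x^-1 = b x * a x^-1) ->
  forall x, b x = 0.
Proof.
move=> two0 aD bD a1 b1 ab1 ab0.
pose n x := a x ^+ 2 + b x ^+ 2.
(* [n x] is the norm of [z x], and norms are multiplicative. *)
have nV x : x != 0 -> n x * n x^-1 = 1.
  move=> x0; transitivity ((a x * a x^-1 + b x * b x^-1) ^+ 2
    + (a x * b x^-1 - b x * a x^-1) ^+ 2); first by rewrite /n; ring.
  by rewrite ab1 // ab0 // subrr; ring.
have n0 x : x != 0 -> n x != 0.
  move=> x0; apply: contraNneq (oner_neq0 F) => n0.
  by rewrite -(nV x x0) n0 mul0r.
have aV x : x != 0 -> a x^-1 = a x / n x.
  move=> x0; apply: (mulIf (n0 x x0)); rewrite divfK ?n0 //.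
  rewrite -[RHS]mulr1 -(ab1 x x0).
  have := ab0 x x0; rewrite /n => z.
  transitivity (a x ^+ 2 * a x^-1 + b x * (b x * a x^-1)); first ring.
  by rewrite -z; ring.
have bV x : x != 0 -> b x^-1 = b x / n x.
  move=> x0; apply: (mulIf (n0 x x0)); rewrite divfK ?n0 //.
  rewrite -[RHS]mulr1 -(ab1 x x0).
  have := ab0 x x0; rewrite /n => z.
  transitivity (a x * (a x * b x^-1) + b x ^+ 2 * b x^-1); first ring.
  by rewrite z; ring.
have aX x : a (x ^+ 2) = a x ^+ 2 - b x ^+ 2.
  have [->|x0] := eqVneq x 0; first by
    rewrite expr0n /= (add_morph0 aD) (add_morph0 bD); ring.
  have [->|x1] := eqVneq x (-1).
    by rewrite sqrrN expr1n (add_morphN aD) (add_morphN bD) a1 b1; ring.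
  have y0 : x + 1 != 0 by rewrite addr_eq0.
  have z0 : x * (x + 1) != 0 by rewrite mulf_neq0.
  have zV : (x * (x + 1))^-1 = x^-1 - (x + 1)^-1.
    by field; rewrite x0 y0.
  have nx := n0 x x0; have ny := n0 _ y0.
  have nyE : n (x + 1) = (a x + 1) ^+ 2 + b x ^+ 2.
    by rewrite /n aD bD a1 b1 addr0.
  have az : a (x * (x + 1))^-1 = a x / n x - (a x + 1) / n (x + 1).
    by rewrite zV aD (add_morphN aD) !aV // aD a1.
  have bz : b (x * (x + 1))^-1 = b x / n x - b x / n (x + 1).
    by rewrite zV bD (add_morphN bD) !bV // bD b1 addr0.
  have nzE : n (x * (x + 1))^-1 = (n x * n (x + 1))^-1.
    rewrite {1}/n az bz nyE /n; field.
    by rewrite -nyE ny -/(n x) nx.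
  have := aV _ (invr_neq0 z0); rewrite invrK nzE az invrK.
  rewrite mulrDr mulr1 aD -expr2 => /(canRL (addrK _)) ->.
  rewrite nyE /n; field.
  by rewrite -nyE ny -/(n x) nx.
move=> x; have [->|x0] := eqVneq x 0; first exact: (add_morph0 bD).
have := aX (x + x^-1).
(* Computing the first coordinate of the square in both ways leaves, up to a
   factor 2, [(a x ^+ 2 - b x ^+ 2) / n x = 1], that is [2 * b x ^+ 2 = 0]. *)
have -> : (x + x^-1) ^+ 2 = x ^+ 2 + (1 + 1) + x^-1 ^+ 2 by field.
rewrite !aD bD a1 !aX aV // bV // => h.
have nx := n0 x x0.
have : 2%:R * (b x ^+ 2) * 2%:R = 0.
  apply: (mulIf (invr_neq0 nx)); rewrite mul0r.
  rewrite -[RHS](subrr ((a x + a x / n x) ^+ 2 - (b x + b x / n x) ^+ 2)) -{1}h.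
  by rewrite {1 2 3 4 5}/n; field; rewrite -/(n x).
by move=> /eqP; rewrite !mulf_eq0 (negbTE two0) orbF /= orbb => /eqP.
Qed.

(** * Additive maps preserving natural lengths *)

(** The squares of [x^-1 - x] and [x^-1 + x] differ by 4, and for every [m] so
    do those of [m - m^-1] and [m + m^-1]; scaling by [m], two right triangles with
    these legs and hypotenuses share their second leg.  It exists once [m] is
    large. *)
Lemma natural_right_triangles (R : realType) (x : R) :
  x != 0 -> exists (m : nat) (k : R),
  [/\ (0 < m)%N, 0 < k,
      (m%:R * (x^-1 - x)) ^+ 2 + k ^+ 2 = (m ^ 2 - 1)%N%:R ^+ 2
    & (m%:R * (x^-1 + x)) ^+ 2 + k ^+ 2 = (m ^ 2 + 1)%N%:R ^+ 2].
Proof.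
move=> x0; set h := x^-1 - x; pose m := (Num.bound `|h|).+2; exists m.
have h0 := normr_ge0 h.
have mE : `|h| + 2 < m%:R.
  rewrite (_ : m%:R = (Num.bound `|h|)%:R + 2) ?ltrD2r ?archi_boundP //.
  by rewrite -natrD addn2.
have pos : 0 < (m%:R ^+ 2 - 1) ^+ 2 - (m%:R * h) ^+ 2.
  rewrite exprMn -(real_normK (num_real h)) -exprMn subr_sqr.
  by apply: mulr_gt0; nra.
exists (Num.sqrt ((m%:R ^+ 2 - 1) ^+ 2 - (m%:R * h) ^+ 2)).
rewrite natrD natrB ?expn_gt0 // natrX sqrtr_gt0 sqr_sqrtr ?ltW //.
by split=> //; rewrite /h; field.
Qed.

Section AdditiveIsometry.
Variables (R : realType) (F : fieldType) (G : 'rV[R]_2 -> 'rV[F]_2).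
Hypothesis charF0 : [pchar F] =i pred0.
Hypothesis GD : {morph G : v w / v + w}.
Hypothesis G_dist :
  forall n w, dot w w = n%:R ^+ 2 -> dot (G w) (G w) = n%:R ^+ 2.

Lemma GMn n w : G (n%:R *: w) = n%:R *: G w.
Proof.
rewrite !scaler_nat; elim: n => [|n IHn]; first exact: add_morph0.
by rewrite !mulrS GD IHn.
Qed.

Lemma GMnD m x y e :
  G ((m%:R * (x + y)) *: e) = m%:R *: (G (x *: e) + G (y *: e)).
Proof. by rewrite -scalerA GMn scalerDl GD. Qed.

Lemma GMnB m x y e :
  G ((m%:R * (x - y)) *: e) = m%:R *: (G (x *: e) - G (y *: e)).
Proof. by rewrite GMnD scaleNr (add_morphN GD). Qed.

(** The two points symmetric with respect to the line of [e] have the same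
    natural length [n], hence so do [g + g'] and [g - g']. *)
Lemma right_triangle_image e s k n :
  dot e e = 1 -> s ^+ 2 + k ^+ 2 = n%:R ^+ 2 ->
  dot (G (s *: e)) (G (k *: turn e)) = 0 /\
  dot (G (s *: e)) (G (s *: e)) + dot (G (k *: turn e)) (G (k *: turn e))
    = n%:R ^+ 2.
Proof.
move=> ee sk; set g := G (s *: e); set g' := G (k *: turn e).
have hD : dot (g + g') (g + g') = n%:R ^+ 2.
  by rewrite -GD; apply: G_dist; rewrite -/(frame e s k) dot_frame ee mulr1.
have hB : dot (g - g') (g - g') = n%:R ^+ 2.
  rewrite -(add_morphN GD) -GD -scaleNr; apply: G_dist.
  by rewrite -/(frame e s (- k)) dot_frame ee mulr1 mulrNN.
have two0 : 2%:R != 0 :> F by rewrite (natr_eq0_char0 charF0).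
split; apply: (mulfI two0).
  apply: (mulfI two0); rewrite !mulr0 -(subrr (n%:R ^+ 2)) -{1}hD -hB.
  by rewrite /dot !mxE; ring.
transitivity (dot (g + g') (g + g') + dot (g - g') (g - g')).
  by rewrite /dot !mxE; ring.
by rewrite hD hB; ring.
Qed.

(** Subtract the Pythagorean relations of the two triangles: the common leg
    disappears, and the squares of the images of [m (1/x + x)] and
    [m (1/x - x)] differ by [4 m ^ 2] times the product, while the squares of
    the hypotenuses differ by [4 m ^ 2]. *)
Lemma inverse_dot e x : dot e e = 1 -> x != 0 ->
  dot (G (x *: e)) (G (x^-1 *: e)) = 1.
Proof.
move=> ee x0; have [m [k [m_gt0 _ hN hM]]] := natural_right_triangles x0.
have [_ nN] := right_triangle_image ee hN.
have [_ nM] := right_triangle_image ee hM.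
move: nN nM; rewrite GMnB GMnD.
set g := G (x *: e); set g' := G (x^-1 *: e) => nN nM.
have m0 : m%:R != 0 :> F by rewrite (natr_eq0_char0 charF0) -lt0n.
have four0 : 4%:R != 0 :> F by rewrite (natr_eq0_char0 charF0).
apply: (mulfI (mulf_neq0 four0 (expf_neq0 2 m0))); rewrite mulr1.
transitivity ((m ^ 2 + 1)%N%:R ^+ 2 - (m ^ 2 - 1)%N%:R ^+ 2 : F).
  by rewrite -nN -nM /dot !mxE; ring.
by rewrite natrD natrB ?expn_gt0 ?m_gt0 // natrX; ring.
Qed.

(** The images of [1/x + x] and [1/x - x], scaled by [m], are orthogonal to the
    image of the common leg, which is nonzero by [inverse_dot] along the
    perpendicular direction; so they lie on one line, and [x], [1/x] are
    combinations of them. *)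
Lemma inverse_parallel e x : dot e e = 1 -> x != 0 ->
  dot (turn (G (x *: e))) (G (x^-1 *: e)) = 0.
Proof.
move=> ee x0; have [m [k [m_gt0 k0 hN hM]]] := natural_right_triangles x0.
have [oN _] := right_triangle_image ee hN.
have [oM _] := right_triangle_image ee hM.
have g'0 : G (k *: turn e) != 0.
  have := @inverse_dot (turn e) k; rewrite dot_turn gt_eqF // => /(_ ee isT).
  apply: contra_eq_neq => ->.
  by rewrite /dot !mxE !mul0r addr0 eq_sym oner_neq0.
have [c hc] := orthogonal_turn g'0 oN; have [d hd] := orthogonal_turn g'0 oM.
move: hc hd; rewrite GMnB GMnD.
set g := G (x *: e); set h := G (x^-1 *: e) => hc hd.
have m0 : m%:R != 0 :> F by rewrite (natr_eq0_char0 charF0) -lt0n.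
have two0 : 2%:R != 0 :> F by rewrite (natr_eq0_char0 charF0).
apply: (mulfI (mulf_neq0 two0 (expf_neq0 2 m0))); rewrite mulr0.
transitivity (dot (turn (m%:R *: (h + g))) (m%:R *: (h - g))).
  by rewrite /dot !mxE /=; ring.
by rewrite hc hd /dot !mxE /=; ring.
Qed.

(** The coordinates of [G (x *: e)] along [G e] and [turn (G e)] satisfy the
    hypotheses of [conjugate_inverse_real]. *)
Lemma line_image e x : dot e e = 1 ->
  G (x *: e) = dot (G e) (G (x *: e)) *: G e.
Proof.
move=> ee.
have gg : dot (G e) (G e) = 1.
  by rewrite (G_dist (n := 1)) ?ee ?expr1n.
pose a t := dot (G e) (G (t *: e)); pose b t := dot (turn (G e)) (G (t *: e)).
have gE t : G (t *: e) = frame (G e) (a t) (b t) by exact: frame_span.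
rewrite -/(a x) {1}gE (_ : b x = 0) /frame ?scale0r ?addr0 //.
apply: (conjugate_inverse_real (a := a)).
- by rewrite (natr_eq0_char0 charF0).
- by move=> s t; rewrite /a scalerDl GD /dot !mxE; ring.
- by move=> s t; rewrite /b scalerDl GD /dot !mxE; ring.
- by rewrite /a scale1r.
- by rewrite /b scale1r /dot !mxE /=; ring.
- by move=> t t0; rewrite -(inverse_dot ee t0) !gE dot_frame gg mulr1.
- move=> t t0; apply/eqP; rewrite -subr_eq0 -(inverse_parallel ee t0) !gE.
  by rewrite dot_turn_frame gg mulr1.
Qed.

End AdditiveIsometry.

(** * Parallel vectors *)

Lemma lin_dependent_direction (R : realType) (u v : 'rV[R]_2) :
  lin_dependent u v ->
  exists e s t, [/\ dot e e = 1, u = s *: e & v = t *: e].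
Proof.
move=> [al [be [nz h]]].
have [al0|al0] := eqVneq al 0.
  have be0 : be != 0 by apply/eqP => be0; apply: nz.
  have v0 : v = 0.
    by move/eqP: h; rewrite al0 scale0r add0r scaler_eq0 (negbTE be0) => /eqP.
  have [u0|/unit_direction [e [s [ee us]]]] := eqVneq u 0.
    exists (delta_mx 0 0), 0, 0; rewrite u0 v0 scale0r; split=> //.
    by rewrite /dot !mxE /=; ring.
  by exists e, s, 0; rewrite scale0r.
have uE : u = (- (be / al)) *: v.
  apply: (scalerI al0); rewrite scalerA mulrN mulrCA divff // mulr1 scaleNr.
  by apply/eqP; rewrite -addr_eq0 h.
have [v0|/unit_direction [e [s [ee vs]]]] := eqVneq v 0.
  exists (delta_mx 0 0), 0, 0; rewrite uE v0 scale0r scaler0; split=> //.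
  by rewrite /dot !mxE /=; ring.
by exists e, (- (be / al) * s), s; rewrite uE {1}vs scalerA.
Qed.

Theorem theorem8 (R : realType) (F : fieldType)
    (charF0 : [pchar F] =i pred0)
    (f : 'rV[R]_2 -> 'rV[F]_2)
    (hf : preserves_unit_distance f)
    (A B C D : 'rV[R]_2)
    (hABCD : lin_dependent (vec A B) (vec C D)) :
  lin_dependent (vec (f A) (f B)) (vec (f C) (f D)).
Proof.
have f_dist x y : dot (y - x) (y - x) = 1 -> dot (f y - f x) (f y - f x) = 1.
  by rewrite -!phi2E => h; apply: hf; rewrite /eucl_dist h sqrtr1.
pose G w := f w - f 0.
have GE p w : f (p + w) - f p = G w.
  by have := parallelogram_all charF0 f_dist w p 0; rewrite !add0r.
have GD : {morph G : v w / v + w}.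
  by move=> v w; rewrite -(GE v w) /G [RHS]addrC subrKA.
have G_dist n w : dot w w = n%:R ^+ 2 -> dot (G w) (G w) = n%:R ^+ 2.
  by rewrite -(GE 0); apply: natural_dist.
have vecE P Q : vec (f P) (f Q) = G (vec P Q).
  by rewrite -(GE P) /vec (addrC P) subrK.
have [e [s [t [ee AB CD]]]] := lin_dependent_direction hABCD.
(* Both images are multiples of [G e]; the multiples, exchanged, serve as
   coefficients unless the first vanishes. *)
rewrite !vecE AB CD (line_image charF0 GD G_dist s ee).
rewrite (line_image charF0 GD G_dist t ee).
set a := dot _ (G (s *: e)); set c := dot _ (G (t *: e)).
have [a0|a0] := eqVneq a 0.
  exists 1, 0; rewrite a0 !scale0r scaler0 addr0; split=> // -[/eqP].
  by rewrite oner_eq0.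
exists (- c), a; rewrite !scalerA -scalerDl mulNr [c * a]mulrC addNr scale0r.
by split=> // -[_ /eqP]; rewrite (negbTE a0).
Qed.
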